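(* Let $\mathbb{K}$ be a field, $S=\mathbb{K}[x_1,\ldots,x_m,x_{m+1},\ldots,x_{2m}]$, and let $H$ be a simple graph on $\{x_1,\ldots,x_m\}$. Let $I\subseteq S$ be a support-$2$ monomial ideal such that $G(I)$ is the whiskered graph $W_H$, i.e. $E(G(I))=E(H)\cup\{\{x_1,x_{m+1}\},\ldots,\{x_m,x_{2m}\}\}$. Then the following are equivalent: (1) $S/I$ is Cohen-Macaulay; (2) $I$ is unmixed; (3) $I$ does not have any embedded associated primes; (4) for all $1\le i\le m$, $\alpha_{i,m+i}=1$ and $w^1_{i,m+i}\ge \mu_{i,j}$ for every $1\le j\le m$ with $\{x_i,x_j\}\in E(H)$.
   Context: For a monomial ideal $I$, $\mathcal{G}(I)$ denotes its minimal set of monomial generators. $I$ is a support-$2$ monomial ideal if every element of $\mathcal{G}(I)$ has the form $x_i^ax_j^b$ with $i< j$ and $a,b\ge 1$. The underlying simple graph $G(I)$ has an edge $\{x_i,x_j\}$ whenever some element of $\mathcal{G}(I)$ has support $\{x_i,x_j\}$. For an edge $\{x_i,x_j\}$, $\alpha_{i,j}$ is the number of elements of $\mathcal{G}(I)$ with support exactly $\{x_i,x_j\}$, and $\mu_{i,j}$ is the maximum exponent of $x_i$ among these generators. When $\alpha_{i,m+i}=1$, $w^1_{i,m+i}$ denotes the exponent of $x_i$ in the unique element of $\mathcal{G}(I)$ with support $\{x_i,x_{m+i}\}$ (in general $w^1_{i,m+i}=\mu_{i,m+i}$). $I$ is unmixed if all its associated primes have the same height. *)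

(* Defs.v *)
From mathcomp Require Import all_boot all_algebra.
From mathcomp Require Import mpoly.
Set Implicit Arguments. Unset Strict Implicit. Unset Printing Implicit Defensive.
Import GRing.Theory.
Local Open Scope ring_scope.

Section Defs.
Variables (K : fieldType) (n : nat).
Local Notation S := {mpoly K[n]}.

Definition ideal_of := S -> Prop.

Definition ideal_gen (s : seq S) : ideal_of :=
  fun p => exists c : 'I_(size s) -> S, p = \sum_(i < size s) c i * s`_i.

Definition same_ideal (A B : ideal_of) := forall x, A x <-> B x.
Definition sub_ideal (A B : ideal_of) := forall x, A x -> B x.
Definition strict_sub (A B : ideal_of) := sub_ideal A B /\ exists x, B x /\ ~ A x.

Definition is_ideal (J : ideal_of) :=
  [/\ J 0, (forall a b, J a -> J b -> J (a + b)) & (forall r a, J a -> J (r * a))].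

Definition prime_ideal (P : ideal_of) :=
  [/\ is_ideal P, ~ P 1 & forall a b, P (a * b) -> P a \/ P b].

Definition Ass (J : ideal_of) (P : ideal_of) :=
  prime_ideal P /\ exists f : S, forall g, P g <-> J (g * f).

Definition prime_chain (k : nat) (c : nat -> ideal_of) :=
  (forall i, i <= k -> prime_ideal (c i))%N /\
  (forall i, i < k -> strict_sub (c i) (c i.+1))%N.

Definition height_is (P : ideal_of) (h : nat) :=
  (exists c, prime_chain h c /\ same_ideal (c h) P) /\
  (forall k c, prime_chain k c -> same_ideal (c k) P -> k <= h)%N.

Definition unmixed (J : ideal_of) :=
  forall P Q, Ass J P -> Ass J Q -> exists h, height_is P h /\ height_is Q h.

Definition no_embedded_primes (J : ideal_of) :=
  ~ exists P Q, [/\ Ass J P, Ass J Q & strict_sub P Q].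

Definition dim_quot_is (J : ideal_of) (d : nat) :=
  (exists c, prime_chain d c /\ sub_ideal J (c 0%N)) /\
  (forall k c, prime_chain k c -> sub_ideal J (c 0%N) -> k <= d)%N.

Definition max_homog : ideal_of := fun p => p@_0 = 0.

Definition regular_seq (s : seq S) (f : seq S) :=
  [/\ (forall i, (i < size f)%N -> max_homog f`_i),
      (forall i, (i < size f)%N -> forall g,
          ideal_gen (s ++ take i f) (g * f`_i) -> ideal_gen (s ++ take i f) g)
    & ~ ideal_gen (s ++ f) 1].

Definition depth_quot_is (s : seq S) (d : nat) :=
  (exists f, regular_seq s f /\ size f = d) /\
  (forall f, regular_seq s f -> size f <= d)%N.

(* S/(ideal_gen s) is Cohen-Macaulay (graded setting: depth = dim) *)
Definition cohen_macaulay (s : seq S) :=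
  exists d, depth_quot_is s d /\ dim_quot_is (ideal_gen s) d.

Definition mon_ideal (gens : seq 'X_{1..n}) : seq S := [seq 'X_[u] | u <- gens].

Definition mingens (gens : seq 'X_{1..n}) : seq 'X_{1..n} :=
  undup [seq u <- gens | all (fun v => (v <= u)%MM ==> (v == u)) gens].

Definition msupp (u : 'X_{1..n}) : {set 'I_n} := [set k | (0 < u k)%N].

Definition support2 (gens : seq 'X_{1..n}) :=
  forall u, u \in mingens gens -> #|msupp u| = 2%N.

Definition ugraph_edge (gens : seq 'X_{1..n}) (a b : 'I_n) :=
  a != b /\ exists2 u, u \in mingens gens & msupp u = [set a; b].

Definition alpha (gens : seq 'X_{1..n}) (a b : 'I_n) : nat :=
  count (fun u => msupp u == [set a; b]) (mingens gens).

Definition mu (gens : seq 'X_{1..n}) (a b : 'I_n) : nat :=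
  \max_(u <- mingens gens | msupp u == [set a; b]) u a.

End Defs.

(* whiskered graph W_H on 'I_(m+m): x_i = lshift m i, x_{m+i} = rshift m i *)
Definition whisker_edge (m : nat) (H : rel 'I_m) (a b : 'I_(m + m)) : Prop :=
  (exists i j : 'I_m, [/\ a = lshift m i, b = lshift m j & H i j]) \/
  (exists i : 'I_m, (a = lshift m i /\ b = rshift m i) \/ (a = rshift m i /\ b = lshift m i)).

(* Main.v *)
(** The height and depth bounds come from one device.  If [p = F(f_1, ..., f_r)] for a
    nonzero polynomial [F] over [K], then (a) [p] avoids [c_0] whenever [f_i] lies in
    [c_i] but not in [c_(i-1)] for a chain of primes [c_0 < ... < c_r], and (b) if the
    [f_i] form a regular sequence on [S/J] inside the maximal homogeneous ideal, then
    [p v] in [J] forces [v] into [J + m^k] for every [k].  Counting monomials, such a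
    [p] exists in the prime [P_C] generated by the variables in [C] as soon as [r]
    exceeds the number of variables outside [C].  Hence [P_C] has height [#|C|], and
    regular sequences on [S/I] have length at most [dim S/P_C] for [P_C] in [Ass(S/I)].

    If (4) fails, a suitable proper divisor of a minimal generator extends to a monomial
    [v] with [I : v = P_C], where [C] contains both ends of a whisker; as [C] minus the
    leaf is still a vertex cover, [P_C] is embedded and has height greater than [m].
    If (4) holds, the differences [y_i - x_i] form a regular sequence on [S/I]: modulo
    the first ones, [I] becomes the monomial ideal obtained by substituting [x_i] for
    [y_i].  So an associated prime contains exactly one end of each whisker. *)

Require Import Defs.
From mathcomp Require Import all_boot all_algebra.
From mathcomp Require Import mpoly.
From mathcomp Require Import ring zify.
From Stdlib Require Import Classical ClassicalEpsilon.
Set Implicit Arguments. Unset Strict Implicit. Unset Printing Implicit Defensive.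
Import GRing.Theory.
Local Open Scope ring_scope.

(** * Regular sequences and values of polynomials *)

Section Ideals.
Variables (K : fieldType) (n : nat).
Local Notation S := {mpoly K[n]}.
Implicit Types (J A B : ideal_of K n) (s fs : seq S) (p q f g u v : S).

Lemma is_ideal0 J : is_ideal J -> J 0. Proof. by case. Qed.

Lemma is_idealD J p q : is_ideal J -> J p -> J q -> J (p + q).
Proof. by case=> _ + _; apply. Qed.

Lemma is_idealMl J p q : is_ideal J -> J q -> J (p * q).
Proof. by case=> _ _; apply. Qed.

Lemma is_idealMr J p q : is_ideal J -> J p -> J (p * q).
Proof. by rewrite mulrC; apply: is_idealMl. Qed.

Lemma is_idealN J p : is_ideal J -> J p -> J (- p).
Proof. by move=> iJ Jp; rewrite -mulN1r; apply: is_idealMl. Qed.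

Lemma is_idealB J p q : is_ideal J -> J p -> J q -> J (p - q).
Proof. by move=> iJ Jp Jq; apply: is_idealD => //; apply: is_idealN. Qed.

Lemma is_ideal_sum J (T : Type) (r : seq T) (P : pred T) (F : T -> S) :
  is_ideal J -> (forall i, P i -> J (F i)) -> J (\sum_(i <- r | P i) F i).
Proof.
move=> iJ JF; apply: (big_ind J) => //; first exact: is_ideal0.
by move=> x y; apply: is_idealD.
Qed.

Lemma ideal_gen_is_ideal s : is_ideal (ideal_gen s).
Proof.
split.
- by exists (fun=> 0); rewrite big1 // => i _; rewrite mul0r.
- move=> _ _ [c ->] [d ->]; exists (fun i => c i + d i).
  by rewrite -big_split /=; apply: eq_bigr => i _; rewrite mulrDl.
- move=> r _ [c ->]; exists (fun i => r * c i).
  by rewrite mulr_sumr; apply: eq_bigr => i _; rewrite mulrA.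
Qed.

Lemma mem_ideal_gen s f : f \in s -> ideal_gen s f.
Proof.
move=> fs; have ks : (index f s < size s)%N by rewrite index_mem.
exists (fun i => (i == Ordinal ks)%:R).
rewrite (bigD1 (Ordinal ks)) //= eqxx mul1r nth_index // big1 ?addr0 //.
by move=> i /negbTE->; rewrite mul0r.
Qed.

Lemma ideal_gen_min s J :
  is_ideal J -> (forall f, f \in s -> J f) -> sub_ideal (ideal_gen s) J.
Proof.
move=> iJ Js _ [c ->]; apply: is_ideal_sum => // i _.
by apply: is_idealMl => //; apply: Js; rewrite mem_nth.
Qed.

Definition addgen J f : ideal_of K n := fun p => exists2 q, J q & exists r, p = q + f * r.

Lemma addgen_is_ideal J f : is_ideal J -> is_ideal (addgen J f).
Proof.
move=> iJ; split.
- by exists 0; [exact: is_ideal0 | exists 0; rewrite mulr0 addr0].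
- move=> _ _ [a Ja [r ->]] [b Jb [t ->]].
  by exists (a + b); [exact: is_idealD | exists (r + t); ring].
- move=> c _ [a Ja [r ->]].
  by exists (c * a); [exact: is_idealMl | exists (c * r); ring].
Qed.

Lemma ideal_gen_rcons s f : same_ideal (ideal_gen (rcons s f)) (addgen (ideal_gen s) f).
Proof.
have iJ := ideal_gen_is_ideal s; have iA := ideal_gen_is_ideal (rcons s f).
move=> p; split.
  apply: ideal_gen_min; first exact: addgen_is_ideal.
  move=> g; rewrite mem_rcons inE => /orP[/eqP->|gs].
    by exists 0; [exact: is_ideal0 | exists 1; rewrite add0r mulr1].
  by exists g; [exact: mem_ideal_gen | exists 0; rewrite mulr0 addr0].
case=> q Jq [r ->]; apply: (is_idealD iA); last first.
  by apply: is_idealMr => //; apply: mem_ideal_gen; rewrite mem_rcons mem_head.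
by apply: ideal_gen_min Jq => // g gs; apply: mem_ideal_gen; rewrite mem_rcons inE gs orbT.
Qed.

Lemma prime_idealX (P : ideal_of K n) f k : prime_ideal P -> P (f ^+ k) -> P f.
Proof.
move=> [iP P1 PM]; elim: k => [|k IH]; first by rewrite expr0.
by rewrite exprS => /PM[].
Qed.

(** Regularity without properness of the quotient. The ideal is a predicate, so that an induction
    may change it freely, for instance to [J] plus [f ^+ k]. *)
Fixpoint wregular J fs : Prop :=
  if fs is f :: fs' then (forall g, J (g * f) -> J g) /\ wregular (addgen J f) fs'
  else True.

Lemma wregular_ext A B fs : same_ideal A B -> wregular A fs -> wregular B fs.
Proof.
elim: fs A B => //= f fs IH A B eAB [Af Afs]; split=> [g|].
  by move/eAB/Af/eAB.
by apply: IH Afs => p; split=> -[q /eAB Aq ?]; exists q.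
Qed.

Lemma regular_seq_wregular s fs : regular_seq s fs -> wregular (ideal_gen s) fs.
Proof.
case=> _ + _; elim: fs s => //= f fs IH s reg; split.
  by have := reg 0 isT; rewrite take0 cats0.
apply: (wregular_ext (ideal_gen_rcons s f)); apply: IH => i ilt g.
by have := reg i.+1 ilt g; rewrite /= cat_rcons.
Qed.

(* The hypotheses say that 0 -> S/A -x-> S/J -> S/(J+x) -> 0 is exact; weak
   regularity is inherited by the middle term of such an extension. *)
Lemma wregular_extension A J x fs : is_ideal J ->
    (forall h, J (x * h) <-> A h) ->
  wregular A fs -> wregular (addgen J x) fs -> wregular J fs.
Proof.
elim: fs A J => //= f fs IH A J iJ AJ [Af Afs] [Jf Jfs]; split.
  move=> g Jgf; have [|a Ja [k gE]] := Jf g.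
    by exists (g * f) => //; exists 0; rewrite mulr0 addr0.
  rewrite gE; apply: is_idealD => //; apply/AJ/Af/AJ.
  have -> : x * (k * f) = g * f - a * f by rewrite gE; ring.
  by apply: is_idealB => //; apply: is_idealMr.
apply: (IH (addgen A f)) => //; first exact: addgen_is_ideal.
- move=> h; split=> [[a Ja [k hE]]|[a Aa [r ->]]].
    have [|b Jb [l kE]] := Jf k.
      exists (- a); first exact: is_idealN.
      by exists h; rewrite hE; ring.
    exists (h - f * l); last by exists l; ring.
    apply/AJ; have -> : x * (h - f * l) = a + f * b.
      by rewrite mulrBr hE kE; ring.
    by apply: is_idealD => //; apply: is_idealMl.
  by exists (x * a); [exact/AJ | exists (x * r); ring].
- apply: wregular_ext Jfs => p; split=> [[_ [a Ja [k ->]] [l ->]]|[_ [a Ja [k ->]] [l ->]]].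
    by exists (a + f * l); [exists a => //; exists l | exists k; ring].
  by exists (a + x * l); [exists a => //; exists l | exists k; ring].
Qed.

(** Induction along 0 -> S/(J+f) -> S/(J+f^(k+1)) -> S/(J+f^k) -> 0, whose first map is
    multiplication by f^k. *)
Lemma wregular_exp J f fs k : is_ideal J -> wregular J (f :: fs) ->
  wregular (addgen J (f ^+ k.+1)) fs.
Proof.
move=> iJ [Jf Jfs].
have Jfk : forall i g, J (g * f ^+ i) -> J g.
  by elim=> [|i IH] g; rewrite ?expr0 ?mulr1 // exprSr mulrA => /Jf/IH.
elim: k => [|k IH]; first by rewrite expr1.
apply: (@wregular_extension (addgen J f) _ (f ^+ k.+1)) => //.
- exact: addgen_is_ideal.
- move=> h; split=> [[a Ja [r hE]]|[a Ja [r ->]]].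
    exists (h - f * r); last by exists r; ring.
    apply: (Jfk k.+1); have -> : (h - f * r) * f ^+ k.+1 = a; last by [].
    by rewrite mulrBl mulrC hE exprS; ring.
  exists (f ^+ k.+1 * a); first exact: is_idealMl.
  by exists r; rewrite !exprS; ring.
- apply: wregular_ext IH => p; split=> [[a Ja [r ->]]|[_ [a Ja [r ->]] [t ->]]].
    exists a; last by exists r.
    by exists a => //; exists 0; rewrite mulr0 addr0.
  by exists a => //; exists (f * r + t); rewrite !exprS; ring.
Qed.

(* [nzval fs p] holds for the values p = F(fs) of nonzero polynomials F over K:
   factor out of F the largest power of the first variable, and recurse on the
   part of the cofactor not involving that variable. *)
Fixpoint nzval fs p : Prop :=
  if fs is f :: fs' then
    exists e p0 p1, p = f ^+ e * (p0 + f * p1) /\ nzval fs' p0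
  else exists2 c : K, c != 0 & p = c%:MP.

(** Modulo [f], the [k]-th power of the cofactor [p0 + f * p1] is [p0 ^+ k]. *)
Lemma nzvalX fs p k : nzval fs p -> nzval fs (p ^+ k).
Proof.
elim: fs p => [|f fs IH] p /=.
  by case=> c c0 ->; exists (c ^+ k); rewrite ?expf_neq0 // rmorphXn.
case=> e [p0 [p1 [-> /IH nz0]]].
set q := p0 + f * p1; have fE : f * p1 = q - p0 by rewrite /q; ring.
exists (e * k)%N, (p0 ^+ k), (p1 * \sum_(i < k) q ^+ (k.-1 - i) * p0 ^+ i).
split=> //; rewrite exprMn exprM mulrA fE -subrXX; ring.
Qed.

(** Membership in the [k]-th power of the maximal homogeneous ideal. *)
Definition ord_ge k p := forall m, m \in msupp p -> (k <= mdeg m)%N.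

Lemma ord_geD k p q : ord_ge k p -> ord_ge k q -> ord_ge k (p + q).
Proof. by move=> kp kq m /msuppD_le; rewrite mem_cat => /orP[/kp|/kq]. Qed.

Lemma ord_geM k l p q : ord_ge k p -> ord_ge l q -> ord_ge (k + l) (p * q).
Proof.
move=> kp lq m /msuppM_le/allpairsP[[a b] /= [/kp ka /lq lb ->]].
by rewrite mdegD leq_add.
Qed.

Lemma ord_geX k f : max_homog f -> ord_ge k (f ^+ k).
Proof.
move=> f0; elim: k => [|k IH]; first by move=> m.
rewrite exprS -add1n; apply: ord_geM => // m.
rewrite lt0n mdeg_eq0 mcoeff_msupp; apply: contraNneq => ->; exact/eqP.
Qed.

(* Krull-intersection-free core of "depth <= dim S/P": an element killed by a
   nonzero polynomial in a weakly regular sequence is infinitely divisible. *)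
Lemma nzval_adic_closure J fs p v : is_ideal J -> wregular J fs ->
    (forall f, f \in fs -> max_homog f) -> nzval fs p -> J (p * v) ->
  forall k, exists2 q, J q & ord_ge k (v - q).
Proof.
move=> + + + + + k; elim: fs J p v => [|f fs IH] J p v iJ /=.
  move=> _ _ [c c0 ->] Jv; exists v; last by rewrite subrr => m; rewrite -mpolyC0 msupp0.
  by rewrite -[v]mul1r -mpolyC1 -(mulVf c0) mpolyCM -mulrA; apply: is_idealMl.
move=> wreg mf [e [p0 [p1 [-> nz0]]]] Jv.
have {}Jv : J ((p0 + f * p1) * v).
  case: wreg => Jf _; elim: e Jv => [|e IHe]; first by rewrite expr0 mul1r.
  by rewrite exprS => Jv; apply/IHe/Jf; move: Jv; congr J; ring.
have [->|k0] := posnP k; first by exists 0; first exact: is_ideal0.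
(* Adjoining [f ^+ k] instead of [f] makes the remainder [f ^+ k * b] have order at least [k]. *)
have [|||||q [a Ja [b ->]] kq] := IH (addgen J (f ^+ k)) (p0 ^+ k) v.
- exact: addgen_is_ideal.
- by rewrite -(prednK k0); apply: wregular_exp.
- by move=> g gfs; apply: mf; rewrite inE gfs orbT.
- exact: nzvalX.
(* This difference of [k]-th powers is a multiple of [p0 + f * p1]. *)
- exists ((p0 ^+ k - (- (f * p1)) ^+ k) * v); last first.
    by exists ((- p1) ^+ k * v); rewrite -mulrN exprMn; ring.
  rewrite subrXX opprK mulrAC; exact: is_idealMr.
exists a => //; have -> : v - a = v - (a + f ^+ k * b) + f ^+ k * b by ring.
apply: ord_geD => //; rewrite -[k]addn0; apply: ord_geM => [|m //].
by rewrite addn0; apply: ord_geX; apply: mf; rewrite mem_head.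
Qed.

(** With [f] in [c 1] but not in [c 0], a value [f ^+ e * (p0 + f * p1)] in [c 0] forces [p0] into
    [c 1], against the induction hypothesis for the rest of the chain. *)
Lemma prime_chain_nzval c k : prime_chain k c ->
  exists fs, size fs = k /\ forall p, nzval fs p -> ~ c 0%N p.
Proof.
elim: k c => [|k IH] c [cP cS].
  exists [::]; split=> // _ [a a0 ->] c0a; have [ic0 c01 _] := cP 0%N isT.
  by apply: c01; rewrite -mpolyC1 -(mulVf a0) mpolyCM; apply: is_idealMl.
have [|fs [sfs cfs]] := IH (fun i => c i.+1).
  by split=> i; [exact: (cP i.+1) | exact: (cS i.+1)].
have [sub01 [f [c1f c0f]]] := cS 0%N isT.
exists (f :: fs); split; first by rewrite /= sfs.
move=> _ [e [p0 [p1 [-> nz0]]]] c0p; apply: (cfs p0 nz0).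
have P0 := cP 0%N isT; have [ic0 _ c0M] := P0; have [ic1 _ _] := cP 1%N isT.
have {}c0p : c 0%N (p0 + f * p1) by case: (c0M _ _ c0p) => // /(prime_idealX P0).
rewrite -[p0](addrK (f * p1)); apply: is_idealB => //; first exact: sub01.
exact: is_idealMr.
Qed.

End Ideals.

(** * Monomial ideals and primes generated by variables *)

Section Monomials.
Variables (K : fieldType) (n : nat).
Local Notation S := {mpoly K[n]}.
Implicit Types (J : ideal_of K n) (C D : {set 'I_n}) (m u v : 'X_{1..n}).
Implicit Types (fs : seq S) (p q f g : S) (U : pred 'X_{1..n}).

Lemma mpoly_ideal_ind J p : is_ideal J ->
  (forall m, m \in msupp p -> J 'X_[m]) -> J p.
Proof.
move=> iJ JX; rewrite (mpolyE p) big_seq; apply: is_ideal_sum => // m /JX Jm.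
by rewrite -mul_mpolyC; apply: is_idealMl.
Qed.

Definition monideal U : ideal_of K n := fun p => forall m, m \in msupp p -> U m.

Definition upclosed U := forall u v, U u -> U (u + v)%MM.

Lemma upclosed_le U u v : upclosed U -> (u <= v)%MM -> U u -> U v.
Proof. by move=> upU uv Uu; rewrite -(submK uv) addmC; apply: upU. Qed.

Lemma monideal_is_ideal U : upclosed U -> is_ideal (monideal U).
Proof.
move=> upU; split=> [m|a b Ja Jb m|r a Ja m].
- by rewrite -mpolyC0 msupp0.
- by move/msuppD_le; rewrite mem_cat => /orP[/Ja|/Jb].
- by move/msuppM_le/allpairsP=> [[x y] /= [_ /Ja Uy ->]]; rewrite addmC; apply: upU.
Qed.

Lemma monidealX U m : monideal U 'X_[m] <-> U m.
Proof.
split=> [|Um m']; first by apply; rewrite msuppX mem_head.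
by rewrite msuppX inE => /eqP->.
Qed.

Definition divisible (gens : seq 'X_{1..n}) m := has (fun u => u <= m)%MM gens.

Lemma divisible_upclosed gens : upclosed (divisible gens).
Proof.
move=> u v /hasP[g gg gu]; apply/hasP; exists g => //.
by apply: lepm_trans gu _; apply: lem_addr.
Qed.

Lemma ideal_gen_monomials gens :
  same_ideal (ideal_gen (mon_ideal K gens)) (monideal (divisible gens)).
Proof.
have iG := ideal_gen_is_ideal (mon_ideal K gens).
have iM := monideal_is_ideal (@divisible_upclosed gens).
move=> p; split.
  apply: ideal_gen_min => // _ /mapP[u gu ->]; apply/monidealX.
  by apply/hasP; exists u => //; apply: lepm_refl.
move=> Jp; apply: mpoly_ideal_ind => // m /Jp/hasP[u gu um].
rewrite -(submK um) mpolyXD; apply: is_idealMl => //.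
by apply: mem_ideal_gen; apply: map_f.
Qed.

(** A normal form modulo the monomial ideal, used to replace a polynomial by one with all monomials
    outside [U]. *)
Lemma monideal_strip U p : exists2 q, monideal U (p - q) &
  forall m, m \in msupp q -> m \in msupp p /\ ~~ U m.
Proof.
pose q := \sum_(m <- msupp p | ~~ U m) p@_m *: 'X_[m].
have qE m : q@_m = if U m then 0 else p@_m.
  rewrite /q raddf_sum /=; have [mp|mp] := boolP (m \in msupp p); last first.
    rewrite (memN_msupp_eq0 mp) if_same big_seq_cond big1 // => i /andP[ip _].
    rewrite mcoeffZ mcoeffX; case: eqP => [ie|_]; last by rewrite mulr0.
    by rewrite -ie ip in mp.
  rewrite big_mkcond (bigD1_seq m) ?msupp_uniq //= big1 ?addr0 => [|i /negbTE im].
    by rewrite mcoeffZ mcoeffX eqxx mulr1; case: (U m).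
  by case: ifP => // _; rewrite mcoeffZ mcoeffX im mulr0.
exists q => m; rewrite mcoeff_msupp ?mcoeffB qE.
  by case: ifP => // _; rewrite subrr eqxx.
by rewrite mcoeff_msupp; case: ifP => //; rewrite eqxx.
Qed.

Definition off C m := [forall j in C, m j == 0%N].

Lemma offP C m : reflect (forall j, j \in C -> m j = 0%N) (off C m).
Proof. by apply: (iffP forall_inP) => h j /h /eqP. Qed.

Lemma offPn C m : reflect (exists2 j, j \in C & (0 < m j)%N) (~~ off C m).
Proof.
rewrite negb_forall_in; apply: (iffP exists_inP) => -[j jC]; rewrite -?lt0n.
  by exists j.
by exists j => //; rewrite -lt0n.
Qed.

Definition kill_tuple C : n.-tuple S := [tuple if i \in C then 0 else 'X_i | i < n].
Local Notation kill C := (comp_mpoly (kill_tuple C)).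

Lemma killX C m : kill C 'X_[m] = if off C m then 'X_[m] else 0.
Proof.
rewrite comp_mpolyX; case: ifPn => [/offP mC|/offPn[j jC mj]].
  rewrite [RHS]mpolyXE_id; apply: eq_bigr => i _; rewrite tnth_mktuple.
  by case: ifP => // /mC ->; rewrite !expr0.
by rewrite (bigD1 j) //= tnth_mktuple jC expr0n gtn_eqF //= mul0r.
Qed.

Lemma mcoeff_kill C p m : (kill C p)@_m = if off C m then p@_m else 0.
Proof.
rewrite [in LHS](mpolyE p) [in RHS](mpolyE p).
rewrite (raddf_sum (kill C)) !raddf_sum /=.
transitivity (\sum_(i <- msupp p) (if off C m then (p@_i *: 'X_[i])@_m else 0)).
  apply: eq_bigr => i _; rewrite comp_mpolyZ killX !mcoeffZ.
  case: (boolP (off C i)) => oi; rewrite ?mcoeff0 mcoeffX; case: eqP => [<-|_];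
    by rewrite ?oi ?(negbTE oi) ?mulr0 ?if_same.
by case: ifP => // _; rewrite big1.
Qed.

Lemma kill_idem C p : kill C (kill C p) = kill C p.
Proof. by apply/mpolyP => m; rewrite !mcoeff_kill; case: (off C m). Qed.

(** The ideal generated by the variables in [C], taken as the kernel of a substitution so that
    primality is immediate. *)
Definition varprime C : ideal_of K n := fun p => kill C p = 0.

Lemma varprimeP C p : varprime C p <-> forall m, m \in msupp p -> ~~ off C m.
Proof.
split=> [p0 m|h].
  have := mcoeff_kill C p m; rewrite p0 mcoeff0 mcoeff_msupp => pm.
  by apply: contra => om; rewrite pm om.
apply/mpolyP => m; rewrite mcoeff_kill mcoeff0; case: ifP => // om.
by apply: memN_msupp_eq0; apply: contraL om => /h.
Qed.

Lemma varprime_prime C : prime_ideal (varprime C).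
Proof.
split; first split.
- exact: raddf0.
- by move=> a b Pa Pb; rewrite /varprime raddfD /= Pa Pb addr0.
- by move=> r a Pa; rewrite /varprime rmorphM /= Pa mulr0.
- by rewrite /varprime rmorph1; apply/eqP; rewrite oner_eq0.
- move=> a b /eqP; rewrite rmorphM mulf_eq0 => /orP[]/eqP; [by left|by right].
Qed.

Lemma varprime_is_ideal C : is_ideal (varprime C).
Proof. by case: (varprime_prime C). Qed.

Lemma varprimeX C j : varprime C 'X_j <-> j \in C.
Proof.
rewrite varprimeP msuppX; split=> [/(_ _ (mem_head _ _))/offPn[i iC]|jC m].
  by rewrite mnm1E; case: eqP => // ->.
by rewrite inE => /eqP->; apply/offPn; exists j; rewrite // mnm1E eqxx.
Qed.

Lemma varprime_min C J : is_ideal J -> (forall j, j \in C -> J 'X_j) ->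
  sub_ideal (varprime C) J.
Proof.
move=> iJ JC p /varprimeP Pp; apply: mpoly_ideal_ind => // m /Pp/offPn[j jC mj].
have jm : (U_(j) <= m)%MM by rewrite lep1mP -lt0n.
by rewrite -(submK jm) mpolyXD; apply: is_idealMl => //; apply: JC.
Qed.

Lemma varprime_sub C D : sub_ideal (varprime C) (varprime D) <-> C \subset D.
Proof.
split=> [h|/subsetP sCD].
  by apply/subsetP => j /varprimeX/h/varprimeX.
apply: varprime_min; first exact: varprime_is_ideal.
by move=> j /sCD /varprimeX.
Qed.

Lemma varprime_strict C D : C \proper D -> strict_sub (varprime C) (varprime D).
Proof.
case/properP=> sCD [j jD jC]; split; first exact/varprime_sub.
by exists 'X_j; split; [exact/varprimeX | move/varprimeX; apply/negP].
Qed.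

(** * Algebraic dependence by counting monomials *)

Section Counting.
Variable d : nat.

(** Exponent vectors with entries below [d], nested as pairs to match the recursion of [nzval]. *)
Fixpoint expo r : finType := if r is r'.+1 then ('I_d * expo r')%type else unit.

Fixpoint expo_prod fs : expo (size fs) -> S :=
  if fs is f :: fs' then fun e => f ^+ e.1 * expo_prod e.2 else fun=> 1.

Lemma card_expo r : #|expo r| = (d ^ r)%N.
Proof. by elim: r => [|r IH]; rewrite ?card_unit // card_prod IH card_ord expnS. Qed.

(** Grouped by powers of [f], the least power [i0] carrying a nonzero coefficient factors out, and
    its cofactor [h i0] is treated by induction. *)
Lemma expo_sum_nzval fs (c : expo (size fs) -> K) e : c e != 0 ->
  nzval fs (\sum_e c e *: expo_prod e).
Proof.
elim: fs c e => [|f fs IH] c e /= ce.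
  exists (c tt); first by case: e ce.
  by rewrite (bigD1 tt) //= big1 ?addr0 -?alg_mpolyC // => -[].
pose P (i : 'I_d) := [exists x, c (i, x) != 0].
have Pe : P e.1 by apply/existsP; exists e.2; rewrite -surjective_pairing.
case: (arg_minnP (fun i : 'I_d => nat_of_ord i) Pe) => i0 /existsP[x0 cx0] min_i.
pose h (i : 'I_d) := \sum_x c (i, x) *: expo_prod x.
exists i0, (h i0), (\sum_(i : 'I_d | (i0 < i)%N) f ^+ (i - i0).-1 * h i).
split; last exact: IH cx0.
have -> : \sum_(e0 : 'I_d * expo (size fs)) c e0 *: (f ^+ e0.1 * expo_prod e0.2)
    = \sum_(i : 'I_d) f ^+ i * h i.
  rewrite (eq_bigr (fun e0 : 'I_d * _ =>
    c (e0.1, e0.2) *: (f ^+ e0.1 * expo_prod e0.2))); last by case.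
  rewrite -(pair_bigA _ (fun (i : 'I_d) x => c (i, x) *: (f ^+ i * expo_prod x))) /=.
  by apply: eq_bigr => i _; rewrite mulr_sumr; apply: eq_bigr => x _; rewrite scalerAr.
rewrite (bigD1 i0) //= mulrDr; congr (_ + _).
rewrite mulrA mulr_sumr (bigID (fun i : 'I_d => i0 < i)%N) /= [X in _ + X]big1 ?addr0.
  apply: eq_big => [i|i /andP[_ lt_i]].
    by rewrite andbC; case: ltngtP => //= lt_i; rewrite -val_eqE /= gtn_eqF.
  by rewrite mulrA -!exprSr -exprD; congr (f ^+ _ * _); lia.
move=> i /andP[ni0 le_i]; rewrite /h big1 ?mulr0 // => x _.
case: (eqVneq (c (i, x)) 0) => [->|cx]; first by rewrite scale0r.
have /min_i le0 : P i by apply/existsP; exists x.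
by move: ni0; rewrite -val_eqE /= eqn_leq le0 leqNgt le_i.
Qed.

End Counting.

(** The rank is at most the number [N] of columns, so [kermx] is nonzero. *)
Lemma exists_left_kernel (T : finType) N (A : T -> 'I_N -> K) : (N < #|T|)%N ->
  exists c : T -> K, (exists e, c e != 0) /\ forall j, \sum_e c e * A e j = 0.
Proof.
move=> ltN; pose M := \matrix_(i < #|T|, j < N) A (enum_val i) j.
have kM : kermx M != 0.
  by rewrite -mxrank_eq0 mxrank_ker subn_eq0 -ltnNge (leq_ltn_trans (rank_leq_col M)).
have [i [j kij]] := matrix0Pn _ kM.
exists (fun e => kermx M i (enum_rank e)); split.
  by exists (enum_val j); rewrite enum_valK.
move=> k; have /matrixP/(_ i k) := mulmx_ker M; rewrite !mxE => E; rewrite -[RHS]E {E}.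
rewrite (reindex_onto (@enum_val T T) enum_rank) /=; last by move=> x _; exact: enum_rankK.
by apply: eq_big => x; rewrite enum_valK ?eqxx // [M x k]mxE.
Qed.

Definition deg_le b p := forall m, m \in msupp p -> (mdeg m <= b)%N.

Lemma deg_leM b c p q : deg_le b p -> deg_le c q -> deg_le (b + c) (p * q).
Proof.
move=> bp cq m /msuppM_le/allpairsP[[x y] /= [/bp xb /cq yc ->]].
by rewrite mdegD leq_add.
Qed.

Lemma deg_le1 : deg_le 0 1.
Proof. by move=> m; rewrite -mpolyC1 msupp1 inE => /eqP->; rewrite mdeg0. Qed.

Lemma deg_leX b p k : deg_le b p -> deg_le (b * k) (p ^+ k).
Proof.
move=> bp; elim: k => [|k IH]; first by rewrite expr0 muln0; apply: deg_le1.
by rewrite exprS mulnS; apply: deg_leM.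
Qed.

Lemma expo_prod_deg d b fs (e : expo d (size fs)) :
    (forall f, f \in fs -> deg_le b f) ->
  deg_le (size fs * (b * d)) (expo_prod e).
Proof.
elim: fs e => [|f fs IH] /= e bfs; first exact: deg_le1.
rewrite mulSn; apply: deg_leM; last by apply: IH => g gfs; apply: bfs; rewrite inE gfs orbT.
move=> m mf; apply: leq_trans (_ : b * e.1 <= _)%N; last by rewrite leq_mul2l ltnW ?orbT.
by apply: deg_leX mf; apply: bfs; rewrite mem_head.
Qed.

Lemma deg_le_uniform fs : exists b, forall f, f \in fs -> deg_le b f.
Proof.
elim: fs => [|f fs [b bfs]]; first by exists 0%N.
exists (maxn (msize f) b) => g; rewrite inE => /orP[/eqP->|/bfs bg] m mg.
  by rewrite leq_max ltnW ?msize_mdeg_lt.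
by rewrite leq_max bg ?orbT.
Qed.

Lemma deg_le_kill C b p : deg_le b p -> deg_le b (kill C p).
Proof.
move=> bp m; rewrite mcoeff_msupp mcoeff_kill; case: ifP; rewrite ?eqxx // => _.
by rewrite -mcoeff_msupp => /bp.
Qed.

(* Over K[x_j : j \notin C], more polynomials than variables are algebraically
   dependent: there are more products of powers < d of them than monomials
   of the degrees these products can reach. *)
Lemma algebraic_dependence C fs : (#|~: C| < size fs)%N ->
  exists2 p, nzval fs p & varprime C p.
Proof.
move=> lt_fs; have [b bfs] := deg_le_uniform fs.
set r := size fs in lt_fs *; set k := #|~: C| in lt_fs *.
(* [E] exceeds every degree that occurs and [E <= M * d]; hence the [E ^ k] candidate monomials
   number at most [(M * d) ^ k < d ^ k.+1 <= d ^ r]. *)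
pose M := (r * b).+1; pose d := (M ^ k).+1; pose E := (r * (b * d)).+1.
pose A : {pred {ffun 'I_n -> 'I_E}} := pffun_on ord0 (~: C) predT.
pose mon (a : {ffun 'I_n -> 'I_E}) := [multinom nat_of_ord (a i) | i < n].
have cardA : (#|A| < #|expo d r|)%N.
  rewrite card_expo (@card_pffun_on _ _ ord0 (mem (~: C)) predT) card_ord.
  have -> : #|(mem (~: C))| = k by [].
  apply: leq_ltn_trans (_ : M ^ k * d ^ k < _)%N.
    have leE : (E <= M * d)%N by rewrite /E /M; nia.
    by rewrite -expnMn; case: (k) => // k'; rewrite leq_exp2r.
  apply: leq_trans (_ : d * d ^ k <= _)%N; first by rewrite ltn_pmul2r // expn_gt0.
  by rewrite -expnS leq_pexp2l.
have [c [[e ce] cA]] := exists_left_kernel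
  (fun (e : expo d r) (j : 'I_#|A|) => (kill C (expo_prod e))@_(mon (enum_val j))) cardA.
exists (\sum_e c e *: expo_prod e); first exact: expo_sum_nzval ce.
apply/mpolyP => m; rewrite mcoeff0 (raddf_sum (kill C)) raddf_sum /=.
under eq_bigr do rewrite comp_mpolyZ mcoeffZ.
(* Monomials meeting [C] are killed, those of too large degree do not occur, and the rest are
   indexed by [A], where [c] makes the coefficients cancel. *)
have [om|om] := boolP (off C m); last first.
  by rewrite big1 // => i _; rewrite mcoeff_kill (negbTE om) mulr0.
have [dm|dm] := leqP (mdeg m) (r * (b * d)); last first.
  rewrite big1 // => i _; rewrite memN_msupp_eq0 ?mulr0 //; apply/negP => mi.
  by have := deg_le_kill (expo_prod_deg bfs) mi; rewrite leqNgt dm.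
have mE i : (m i < E)%N.
  by rewrite ltnS; apply: leq_trans dm; rewrite mdegE (bigD1 i) //= leq_addr.
pose a := [ffun i => Ordinal (mE i)].
have aA : a \in A.
  apply/pffun_onP; split=> //; apply/subsetP => i; rewrite !inE ffunE -val_eqE /=.
  by apply: contra => iC; rewrite (offP _ _ om).
have mon_a : mon a = m by apply/mnmP => i; rewrite mnmE ffunE.
by have := cA (enum_rank_in aA a); rewrite enum_rankK_in // mon_a.
Qed.

(** A longer chain supplies more polynomials than there are variables off [C]; a value of a nonzero
    polynomial at them then lies in [varprime C], hence in [c 0]. *)
Lemma prime_chain_length C k c : prime_chain k c -> sub_ideal (varprime C) (c 0%N) ->
  (k <= #|~: C|)%N.
Proof.
move=> ch sC; have [fs [sfs cfs]] := prime_chain_nzval ch.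
rewrite leqNgt -sfs; apply/negP => /algebraic_dependence[p nzp Cp].
by apply: (cfs p nzp); apply: sC.
Qed.

End Monomials.

(** * Heights and associated primes *)

Section Heights.
Variables (K : fieldType) (n : nat).
Local Notation S := {mpoly K[n]}.
Local Notation varprime := (@varprime K n).
Implicit Types (C D : {set 'I_n}) (P Q : ideal_of K n) (c : nat -> ideal_of K n).

(** The variables of [D :\: C] are adjoined one at a time. *)
Lemma varprime_chain C D : C \subset D -> exists c,
  [/\ prime_chain (#|D| - #|C|) c, c 0%N = varprime C
    & c (#|D| - #|C|)%N = varprime D].
Proof.
move=> sCD; set s := enum (D :\: C); pose E i := C :|: [set x in take i s].
have szs : size s = (#|D| - #|C|)%N.
  by rewrite -cardE cardsD (setIidPr sCD).
have mem_s x : (x \in s) = (x \in D :\: C) by rewrite mem_enum.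
exists (fun i => varprime (E i)); rewrite -szs; split.
- split=> [i _|i lt_i]; first exact: varprime_prime.
  apply: varprime_strict; apply/properP; split.
    apply/subsetP => x; rewrite !inE => /orP[->//|].
    rewrite (take_nth x lt_i) mem_rcons inE => ->; by rewrite !orbT.
  have [x0 _] : exists x, x \in s by case: (s) lt_i => // x *; exists x; rewrite mem_head.
  exists (nth x0 s i); first by rewrite !inE (take_nth x0 lt_i) mem_rcons mem_head orbT.
  rewrite !inE negb_or; have := mem_nth x0 lt_i; rewrite mem_s inE => /andP[-> _] /=.
  apply/negP => /(nthP x0)[j]; rewrite size_take lt_i => lt_j.
  rewrite nth_take // => /eqP; rewrite nth_uniq ?enum_uniq //; last exact: ltn_trans lt_i.
  by rewrite ltn_eqF.
- by congr varprime; apply/setP => x; rewrite !inE take0 orbF.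
- congr varprime; apply/setP => x; rewrite !inE take_size mem_s inE.
  by have /subsetP/(_ x) := sCD; case: (x \in C) => //= ->.
Qed.

Lemma prime_chain_cat k l c d : prime_chain k c -> prime_chain l d ->
    same_ideal (c k) (d 0%N) ->
  prime_chain (k + l) (fun i => if (i <= k)%N then c i else d (i - k)%N).
Proof.
move=> [cP cS] [dP dS] ecd; split=> i lt_i.
  by case: leqP => ik; [exact: cP | apply: dP; lia].
case: (ltngtP i k) => ik; first exact: cS.
  by rewrite subSn ?(ltnW ik) //; apply: dS; lia.
have [|dsub [x [dx ndx]]] := dS 0%N; first by lia.
rewrite ik subSn // subnn; split; first by move=> y /ecd/dsub.
by exists x; split=> // /ecd.
Qed.

(** A chain ending at [varprime C] extends by [n - #|C|] steps to the ideal of all variables, and no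
    chain is longer than [n]. *)
Lemma varprime_height C : height_is (varprime C) #|C|.
Proof.
split.
  have [c [ch _ cC]] := varprime_chain (sub0set C).
  by move: ch cC; rewrite cards0 subn0 => ch cC; exists c; split=> //; rewrite cC.
move=> k c ch ckC; have [d [dch d0 _]] := varprime_chain (subsetT C).
have /(prime_chain_cat ch dch) cd : same_ideal (c k) (d 0%N) by rewrite d0.
have := prime_chain_length (C := set0) cd; rewrite setC0 cardsT card_ord.
have leC : (#|C| <= n)%N by rewrite -[X in (_ <= X)%N]card_ord max_card.
suff s0 : sub_ideal (varprime set0) (c 0%N) by move/(_ s0); lia.
case: ch => cP _; case: (cP 0%N isT) => ic0 _ _.
by apply: varprime_min => // j; rewrite inE.
Qed.

Lemma height_is_ext P Q h : same_ideal P Q -> height_is P h -> height_is Q h.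
Proof.
move=> ePQ [[c [ch cP]] bnd]; split.
  by exists c; split=> // x; rewrite cP ePQ.
by move=> k d dch dQ; apply: (bnd k d) => // x; rewrite dQ ePQ.
Qed.

Lemma height_is_unique P h k : height_is P h -> height_is P k -> h = k.
Proof.
move=> [[c [ch cP]] bh] [[d [dh dP]] bk]; apply/eqP; rewrite eqn_leq.
by rewrite (bk _ c) // (bh _ d).
Qed.

End Heights.

(** * Associated primes of a monomial ideal and the depth bound *)

Section AssociatedPrimes.
Variables (K : fieldType) (n : nat) (gens : seq 'X_{1..n}).
Local Notation S := {mpoly K[n]}.
Local Notation varprime := (@varprime K n).
Local Notation divg := (divisible gens).
Local Notation I := (@monideal K n divg).
Implicit Types (C D : {set 'I_n}) (u v m : 'X_{1..n}) (P : ideal_of K n).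

Let iI : is_ideal I := monideal_is_ideal K (@divisible_upclosed n gens).

Lemma gens_bound u :
  exists N, (forall z, u z <= N)%N /\ (forall g, g \in gens -> forall z, g z <= N)%N.
Proof.
have le_mdeg v z : (v z <= mdeg v)%N by rewrite mdegE (bigD1 z) //= leq_addr.
exists (\max_(g <- u :: gens) mdeg g); split=> [z|g gg z].
  by apply: leq_trans (le_mdeg u z) _; rewrite big_cons leq_maxl.
apply: leq_trans (le_mdeg g z) _.
by rewrite big_cons leq_max (big_rem g gg) /= leq_maxl orbT.
Qed.

(** Off [C] the exponents of [u] already reach those of every generator, and on [C] the factor [v]
    adds nothing. *)
Lemma divisible_saturated C u v : ~~ divg u -> off C v ->
    (forall z, z \notin C -> forall g, g \in gens -> g z <= u z)%N ->
  ~~ divg (v + u)%MM.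
Proof.
move=> nu /offP vC big_u; apply: contra nu => /hasP[g gg /mnm_lepP gvu].
apply/hasP; exists g => //; apply/mnm_lepP => z.
have [zC|zC] := boolP (z \in C); last exact: big_u.
by have := gvu z; rewrite mnmDE vC.
Qed.

(** Combinatorial conditions forcing [I : 'X_[u]] to be [varprime C]; the last one makes
    multiplication by variables off [C] harmless. *)
Definition witness C u := [/\ ~~ divg u,
  forall j, j \in C -> divg (u + U_(j))%MM
  & forall z, z \notin C -> forall g, g \in gens -> (g z <= u z)%N].

Lemma witness_colon C u : witness C u -> forall g, varprime C g <-> I (g * 'X_[u]).
Proof.
case=> nu uC big_u g; split.
  move/varprimeP=> gC m; rewrite (perm_mem (msuppMX g u)).
  case/mapP=> v /gC/offPn[j jC vj] ->.
  apply: upclosed_le (uC j jC); first exact: divisible_upclosed.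
  apply/mnm_lepP => z; rewrite !mnmDE mnm1E leq_add2l.
  by case: eqP => [<-|].
move=> Ig; apply/varprimeP => v vg; apply/negP => ov.
have /negP[] := divisible_saturated nu ov big_u; rewrite addmC.
by apply: Ig; rewrite (perm_mem (msuppMX g u)) map_f.
Qed.

Lemma witness_Ass C u : witness C u -> Ass (ideal_gen (mon_ideal K gens)) (varprime C).
Proof.
move=> wu; split; first exact: varprime_prime.
by exists 'X_[u] => g; rewrite (witness_colon wu) ideal_gen_monomials.
Qed.

(** A longer sequence has a value [p] in [varprime C], which sends ['X_[u]] into [I]; then ['X_[u]]
    lies in [I] up to terms of arbitrarily high order. *)
Lemma witness_regular_seq C u fs : witness C u -> regular_seq (mon_ideal K gens) fs ->
  (size fs <= #|~: C|)%N.
Proof.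
move=> wu reg; rewrite leqNgt; apply/negP => lt_fs; have [nu _ _] := wu.
have [p nzp /(witness_colon wu) Ipu] := algebraic_dependence lt_fs.
have wreg := wregular_ext (@ideal_gen_monomials K n gens) (regular_seq_wregular reg).
have mfs f : f \in fs -> max_homog f.
  by case: reg => + _ _ => mf /(nthP 0)[i lt_i <-]; apply: mf.
(* Order above [mdeg u] keeps [u] out of the difference, so [u] is a monomial of [q], an element of
   [I]. *)
have [q Iq qu] := nzval_adic_closure iI wreg mfs nzp Ipu (mdeg u).+1.
have /memN_msupp_eq0 : u \notin msupp ('X_[u] - q).
  by apply/negP => /qu; rewrite ltnn.
rewrite mcoeffB mcoeffX eqxx => /eqP; rewrite subr_eq0 => /eqP q1.
by move/negP: nu; apply; apply: Iq; rewrite mcoeff_msupp -q1 oner_eq0.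
Qed.

(* A non-multiple of the generators that is maximal inside a large box. *)
Lemma exists_witness N u : (forall z, u z <= N)%N ->
    (forall g, g \in gens -> forall z, g z <= N)%N -> ~~ divg u ->
  exists C v, [/\ witness C v, (u <= v)%MM & forall z, (z \notin C) = (v z == N)].
Proof.
move=> uN gN nu.
pose mon (a : {ffun 'I_n -> 'I_N.+1}) := [multinom nat_of_ord (a i) | i < n].
pose Q a := (u <= mon a)%MM && ~~ divg (mon a).
pose a0 : {ffun 'I_n -> 'I_N.+1} := [ffun i => inord (u i)].
have mona0 : mon a0 = u by apply/mnmP => i; rewrite mnmE ffunE inordK // ltnS.
have Qa0 : Q a0 by rewrite /Q mona0 lepm_refl.
case: (arg_maxnP (fun a => mdeg (mon a)) Qa0) => a /andP[ua na] amax.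
have aN z : (mon a z <= N)%N by rewrite mnmE -ltnS.
(* A coordinate below [N] can still grow inside the box, so maximality of the degree makes that
   growth land in the ideal. *)
exists [set j | mon a j < N]%N, (mon a); split=> //; last first.
  by move=> z; rewrite inE -leqNgt eqn_leq aN.
split=> // [j|z]; rewrite inE; last first.
  by rewrite -leqNgt => az g gg; apply: leq_trans az; apply: gN.
move=> aj; apply/negPn/negP => naj.
pose b : {ffun 'I_n -> 'I_N.+1} := [ffun i => inord ((mon a + U_(j))%MM i)].
have monb : mon b = (mon a + U_(j))%MM.
  apply/mnmP => i; rewrite mnmE ffunE inordK // ltnS mnmDE mnm1E.
  by case: eqP => [<-|_]; rewrite ?addn1 ?addn0.
have /amax : Q b.
  by rewrite /Q monb naj (lepm_trans ua) ?lem_addr.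
by rewrite monb mdegD mdeg1 /= addn1 ltnn.
Qed.

Lemma prop_set (T : finType) (Q : T -> Prop) : exists A : {set T}, forall x, x \in A <-> Q x.
Proof.
exists [set x | if excluded_middle_informative (Q x) then true else false] => x.
by rewrite inE; case: excluded_middle_informative.
Qed.

Lemma prime_monomial P m : prime_ideal P -> P 'X_[m] -> exists2 j, (0 < m j)%N & P 'X_j.
Proof.
move=> pP; have [iP P1 PM] := pP; rewrite mpolyXE_id => PX.
suff : exists2 j, j \in index_enum 'I_n & P ('X_j ^+ m j).
  case=> j _; case: (posnP (m j)) => [->|mj]; first by rewrite expr0.
  by move/(prime_idealX pP); exists j.
elim: (index_enum _) PX => [|i r IH]; first by rewrite big_nil.
rewrite big_cons => /PM[Pi|/IH[j jr Pj]]; first by exists i; rewrite ?mem_head.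
by exists j; rewrite // inE jr orbT.
Qed.

Lemma Ass_sub P : Ass (ideal_gen (mon_ideal K gens)) P ->
  sub_ideal (ideal_gen (mon_ideal K gens)) P.
Proof.
case=> _ [f Pf] g Ig; apply/Pf; apply: is_idealMr => //.
exact: ideal_gen_is_ideal.
Qed.

(* Multiplying f by a large monomial in the variables outside P does not change
   I : f = P; then no monomial of f times one in those variables lies in I, and
   comparing leading monomials shows that P contains no polynomial in them. *)
Lemma Ass_varprime P : Ass (ideal_gen (mon_ideal K gens)) P ->
  exists C, same_ideal P (varprime C).
Proof.
case=> pP [f Pf]; have [iP P1 PM] := pP.
have {}Pf g : P g <-> I (g * f) by rewrite Pf ideal_gen_monomials.
have [C CP] := prop_set (fun j => P 'X_j).
have sCP : sub_ideal (varprime C) P by apply: varprime_min => // j /CP.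
exists C => g; split; last exact: sCP.
move=> Pg; apply/eqP; apply/negPn/negP; set h := (X in X != 0) => h0.
have Ph : P h.
  have -> : h = g - (g - h) by ring.
  apply: (is_idealB iP) => //; apply: sCP.
  by rewrite /varprime raddfB /= kill_idem subrr.
have [N [_ gN]] := gens_bound 0%MM.
(* No variable of [nu] lies in [P], so ['X_[nu] * f] is outside [I] and its normal form [q] is
   nonzero. *)
pose nu := [multinom if z \in C then 0%N else N | z < n].
have Pnu : ~ P 'X_[nu].
  move/(prime_monomial pP) => [j]; rewrite mnmE => + /CP.
  by case: (j \in C).
have [q Iq qs] := monideal_strip divg ('X_[nu] * f).
have q0 : q != 0.
  by apply/eqP => q0; apply/Pnu/Pf; rewrite -[_ * _]subr0 -q0.
have Ihq : I (h * q).
  have -> : h * q = 'X_[nu] * (h * f) - h * ('X_[nu] * f - q) by ring.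
  apply: (is_idealB iI); apply: (is_idealMl _ iI) => //; exact/Pf.
have /qs[+ nq] := mlead_supp q0.
rewrite mulrC (perm_mem (msuppMX f nu)) => /mapP[v _ qE].
(* [mlead h] avoids [C] and [mlead q] is at least [N] off [C], so the leading monomial of [h * q]
   cannot lie in [I]. *)
have /negP[] : ~~ divg (mlead h + mlead q)%MM.
  apply: (@divisible_saturated C) => //.
    have := mlead_supp h0; rewrite mcoeff_msupp mcoeff_kill.
    by case: ifP => //; rewrite eqxx.
  move=> z zC t tg; rewrite qE mnmDE mnmE (negbTE zC).
  by apply: leq_trans (leq_addr _ _); apply: gN.
by rewrite -mleadM //; apply: Ihq; rewrite mlead_supp // mulf_neq0.
Qed.

Lemma mem_mingens u : u \in mingens gens <->
  u \in gens /\ forall v, v \in gens -> (v <= u)%MM -> v = u.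
Proof.
rewrite mem_undup mem_filter; split=> [/andP[/allP h ug]|[ug h]].
  by split=> // v /h /implyP + vu => /(_ vu)/eqP.
by rewrite ug andbT; apply/allP => v vg; apply/implyP => /h-> //.
Qed.

(** A non-minimal generator has a proper divisor of smaller degree among the generators; the descent
    ends at a minimal one. *)
Lemma divisible_mingens m : divg m = divisible (mingens gens) m.
Proof.
apply/hasP/hasP => [[u]|[u /mem_mingens[ug _] um]]; last by exists u.
have [k] := ubnP (mdeg u); elim: k u => // k IH u lt_k ug um.
have [umin|] := boolP (u \in mingens gens); first by exists u.
rewrite mem_undup mem_filter ug andbT => /allPn[v vg].
rewrite negb_imply => /andP[vu nvu]; apply: (IH v) => //; last exact: lepm_trans um.
apply: leq_trans (_ : mdeg v < mdeg u)%N lt_k.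
rewrite -(submK vu) mdegD -[X in (X < _)%N]add0n ltn_add2r.
rewrite lt0n mdeg_eq0; apply: contra nvu => /eqP uv0.
by rewrite -(submK vu) uv0 add0m.
Qed.

Lemma mingens_lt u v : u \in mingens gens -> (v <= u)%MM -> v != u -> ~~ divg v.
Proof.
case/mem_mingens=> _ umin vu; apply: contra => /hasP[g gg gv].
have gu := umin g gg (lepm_trans gv vu); rewrite gu in gv.
apply/eqP/mnmP => z; apply/eqP; rewrite eqn_leq.
by move/mnm_lepP: vu => ->; move/mnm_lepP: gv => ->.
Qed.

End AssociatedPrimes.

(** * When a difference of two variables is regular modulo a monomial ideal *)

Section RegularDifference.
Variables (K : fieldType) (n : nat) (U : pred 'X_{1..n}).
Implicit Types (p g : {mpoly K[n]}) (m : 'X_{1..n}).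

Lemma exists_extremal_monomial (f : 'X_{1..n} -> nat) p : p != 0 ->
  (exists2 m, m \in msupp p & forall v, v \in msupp p -> (f m <= f v)%N) /\
  (exists2 m, m \in msupp p & forall v, v \in msupp p -> (f v <= f m)%N).
Proof.
rewrite -msupp_eq0; case: (msupp p) => // a s _; split.
  elim: s => [|b s [m ms mmin]]; first by exists a => [|v]; rewrite inE // => /eqP->.
  have [le_mb|lt_bm] := leqP (f m) (f b).
    exists m; first by move: ms; rewrite !inE orbCA => ->; rewrite orbT.
    by move=> v; rewrite !inE orbCA => /orP[/eqP->|] //; rewrite -in_cons => /mmin.
  exists b; first by rewrite !inE eqxx orbT.
  move=> v; rewrite !inE orbCA => /orP[/eqP->|] //.
  by rewrite -in_cons => /mmin; apply: leq_trans; apply: ltnW.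
elim: s => [|b s [m ms mmax]]; first by exists a => [|v]; rewrite inE // => /eqP->.
have [le_bm|lt_mb] := leqP (f b) (f m).
  exists m; first by move: ms; rewrite !inE orbCA => ->; rewrite orbT.
  by move=> v; rewrite !inE orbCA => /orP[/eqP->|] //; rewrite -in_cons => /mmax.
exists b; first by rewrite !inE eqxx orbT.
move=> v; rewrite !inE orbCA => /orP[/eqP->|] //.
by rewrite -in_cons => /mmax le_vm; apply: leq_trans le_vm _; apply: ltnW.
Qed.

(** Outside [U], multiplication by [y] stays outside below the threshold [w], and multiplication by
    [x] does so from [w] on. An extremal monomial of the normal form then gives a term that cannot
    cancel. *)
Lemma monideal_regular (x y : 'I_n) w g : upclosed U -> x != y ->
    (forall m, m x < w -> U (m + U_(y))%MM -> U m)%N ->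
    (forall m, w <= m x -> U (m + U_(x))%MM -> U m)%N ->
  @monideal K n U (g * ('X_y - 'X_x)) -> @monideal K n U g.
Proof.
move=> upU xy Uy Ux Ig; have iI := monideal_is_ideal K upU.
have [q Iq qs] := monideal_strip U g.
case: (eqVneq q 0) => [q0|q0]; first by rewrite q0 subr0 in Iq.
have Iqt : @monideal K n U (q * ('X_y - 'X_x)).
  have -> : q * ('X_y - 'X_x) = g * ('X_y - 'X_x) - (g - q) * ('X_y - 'X_x) by ring.
  by apply: (is_idealB iI) => //; apply: (is_idealMr _ iI).
have [[m mq mmin] [m' mq' mmax]] := exists_extremal_monomial (fun m => m x) q0.
(* Cancelling [m + U_(y)] would need a monomial of [q] with smaller [x]-exponent than the
   minimum. *)
exfalso; have [lt_w|le_w] := ltnP (m x) w.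
  have [_ /negP[]] := qs m mq; apply: Uy => //; apply: Iqt.
  rewrite mcoeff_msupp mulrBr mcoeffB addmC mcoeffMX.
  rewrite [X in _ - X]memN_msupp_eq0 ?subr0 -?mcoeff_msupp //.
  rewrite (perm_mem (msuppMX q _)); apply/negP => /mapP[v /mmin le_mv].
  move/mnmP/(_ x); rewrite !mnmDE !mnm1E eqxx (eq_sym y x) (negbTE xy); lia.
(* Cancelling [m' + U_(x)] would need a monomial of [q] with larger [x]-exponent than the
   maximum. *)
have [_ /negP[]] := qs m' mq'; apply: Ux; first exact: leq_trans le_w (mmin _ mq').
apply: Iqt; rewrite mcoeff_msupp mulrBr mcoeffB addmC mcoeffMX.
rewrite [X in X - _]memN_msupp_eq0 ?sub0r ?oppr_eq0 -?mcoeff_msupp //.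
rewrite (perm_mem (msuppMX q _)); apply/negP => /mapP[v /mmax le_mv].
move/mnmP/(_ x); rewrite !mnmDE !mnm1E eqxx (eq_sym y x) (negbTE xy); lia.
Qed.

End RegularDifference.

(** * Whiskered graphs *)

Section Whiskers.
Variables (K : fieldType) (m : nat) (H : rel 'I_m) (gens : seq 'X_{1..m + m}).
Hypotheses (Isupp2 : support2 gens)
  (IG : forall a b : 'I_(m + m), ugraph_edge gens a b <-> whisker_edge H a b).
Local Notation S := {mpoly K[m + m]}.
Local Notation x := (@lshift m m).
Local Notation y := (@rshift m m).
Local Notation G := (mingens gens).
Local Notation divg := (divisible gens).
Local Notation IK := (ideal_gen (mon_ideal K gens)).
Local Notation varprime := (@varprime K (m + m)).
Implicit Types (i j : 'I_m) (u v : 'X_{1..m + m}) (C D : {set 'I_(m + m)}).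

Lemma msupp_gt0 u a b : Defs.msupp u = [set a; b] -> (0 < u a)%N /\ (0 < u b)%N.
Proof.
move=> uE; have ua : a \in Defs.msupp u by rewrite uE !inE eqxx.
have ub : b \in Defs.msupp u by rewrite uE !inE eqxx orbT.
by move: ua ub; rewrite !inE.
Qed.

Lemma msupp_eq0 u a b z : Defs.msupp u = [set a; b] -> z != a -> z != b -> u z = 0%N.
Proof.
move=> uE za zb; apply/eqP; rewrite -leqn0 leqNgt; apply/negP => uz.
have : z \in Defs.msupp u by rewrite inE.
by rewrite uE !inE (negbTE za) (negbTE zb).
Qed.

Lemma edge_at u a : u \in G -> (0 < u a)%N ->
  exists2 b, whisker_edge H a b & Defs.msupp u = [set a; b].
Proof.
move=> uG ua; have /eqP/cards2P[b [c [nbc uE]]] := Isupp2 uG.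
have : a \in Defs.msupp u by rewrite inE.
rewrite uE !inE => /orP[]/eqP ea.
  by exists c; rewrite ea //; apply/IG; split=> //; exists u.
exists b; rewrite ea 1?setUC //; apply/IG; split; first by rewrite eq_sym.
by exists u; rewrite // setUC.
Qed.

Lemma edge_at_y u i : u \in G -> (0 < u (y i))%N -> Defs.msupp u = [set x i; y i].
Proof.
move=> uG /(edge_at uG)[b + ->].
case=> [[i' [j [/eqP + _ _]]]|[i' [[/eqP + _]|[/rshift_inj<- ->]]]].
- by rewrite eq_rlshift.
- by rewrite eq_rlshift.
- by rewrite setUC.
Qed.

Lemma edge_at_x u i : u \in G -> (0 < u (x i))%N ->
  Defs.msupp u = [set x i; y i] \/ exists2 j, H i j & Defs.msupp u = [set x i; x j].
Proof.
move=> uG /(edge_at uG)[b + ->].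
case=> [[i' [j [/lshift_inj<- -> Hij]]]|[i' [[/lshift_inj<- ->]|[/eqP + _]]]].
- by right; exists j.
- by left.
- by rewrite eq_lrshift.
Qed.

Lemma whisker_gen i : exists2 u, u \in G & Defs.msupp u = [set x i; y i].
Proof.
by have [|_] := (IG (x i) (y i)).2; first by right; exists i; left.
Qed.

Definition cover D := forall u, u \in G -> exists2 z, z \in D & (0 < u z)%N.

Definition xset := [set x i | i : 'I_m].

Lemma x_in_xset i : x i \in xset. Proof. exact: imset_f. Qed.

Lemma y_in_xset i : (y i \in xset) = false.
Proof. by apply/imsetP => -[j _ /eqP]; rewrite eq_rlshift. Qed.

Lemma card_xy D : #|D| = (\sum_i ((x i \in D) + (y i \in D)))%N.
Proof.
rewrite -sum1_card big_mkcond big_split_ord big_split /=.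
by congr (_ + _)%N; apply: eq_bigr => i _; case: ifP.
Qed.

Lemma card_xset : #|xset| = m.
Proof.
rewrite card_xy -[RHS]card_ord -sum1_card; apply: eq_bigr => i _.
by rewrite x_in_xset y_in_xset.
Qed.

Lemma xset_cover : cover xset.
Proof.
move=> u uG; have [a] : exists a, a \in Defs.msupp u.
  by apply/card_gt0P; rewrite (Isupp2 uG).
rewrite inE => /(edge_at uG)[b + /msupp_gt0[ua ub]].
case=> [[i [j [ai _ _]]]|[i [[ai _]|[_ bi]]]]; exists (x i);
  by rewrite ?x_in_xset -?ai -?bi.
Qed.

Lemma cover_xy D i : cover D -> (x i \in D) || (y i \in D).
Proof.
move=> cD; have [u uG uE] := whisker_gen i; have [j jD uj] := cD u uG.
have : j \in Defs.msupp u by rewrite inE.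
by rewrite uE !inE => /orP[]/eqP <-; rewrite jD ?orbT.
Qed.

Lemma cover_card D : cover D -> (m <= #|D|)%N.
Proof.
move=> cD; rewrite card_xy -[X in (X <= _)%N]card_ord -sum1_card.
by apply: leq_sum => i _; have := cover_xy i cD; case: (_ \in D); case: (_ \in D).
Qed.

Lemma cover_card_gt D i : cover D -> x i \in D -> y i \in D -> (m < #|D|)%N.
Proof.
move=> cD xD yD; rewrite card_xy -[X in (X < _)%N]card_ord -sum1_card.
rewrite (bigD1 i) //= [X in (_ < X)%N](bigD1 i) //= xD yD -addnA ltn_add2l add1n ltnS.
by apply: leq_sum => j _; have := cover_xy j cD; case: (_ \in D); case: (_ \in D).
Qed.

Lemma prime_cover (P : ideal_of K (m + m)) : prime_ideal P -> sub_ideal IK P ->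
  exists C, cover C /\ sub_ideal (varprime C) P.
Proof.
move=> pP sIP; have [C CP] := prop_set (fun z => P 'X_z).
exists C; split; last first.
  by apply: varprime_min => [|j /CP //]; case: pP.
move=> u /mem_mingens[ug _].
have [|j uj Pj] := prime_monomial (m := u) pP; last by exists j => //; apply/CP.
by apply: sIP; apply: mem_ideal_gen; apply: map_f.
Qed.

Lemma varprime_cover C : sub_ideal IK (varprime C) -> cover C.
Proof.
move=> sIC u /mem_mingens[ug _].
have /varprimeP : varprime C 'X_[u] by apply: sIC; apply: mem_ideal_gen; apply: map_f.
by move/(_ u); rewrite msuppX mem_head => /(_ isT)/offPn.
Qed.

Lemma witness_cover C v : witness gens C v -> cover C.
Proof. by move=> wv; apply: varprime_cover (Ass_sub (witness_Ass K wv)). Qed.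

(** The monomial with exponent 0 on [D] and [N] off [D] is outside [I], since every generator
    involves [D]. Enlarging it to a witness leaves only coordinates of [D] below [N]. *)
Lemma cover_witness D : cover D -> exists C v, witness gens C v /\ C \subset D.
Proof.
move=> cD; have [N [_ gN]] := gens_bound gens 0%MM.
pose u := [multinom if z \in D then 0%N else N | z < m + m].
have uN z : (u z <= N)%N by rewrite mnmE; case: ifP.
have nu : ~~ divg u.
  rewrite divisible_mingens; apply/hasP => -[g gG /mnm_lepP gu].
  have [j jD gj] := cD g gG; have := gu j.
  by rewrite mnmE jD leqNgt gj.
have [C [v [wv /mnm_lepP uv vN]]] := exists_witness uN gN nu.
exists C, v; split=> //; apply/subsetP => z; apply: contraLR => zD.
have vle : (v z <= N)%N.
  (* A coordinate above [N] would belong to [C]; but raising it further cannot create a divisor, as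
     generators have exponents at most [N]. *)
  rewrite leqNgt; apply/negP => ltv.
  have zC : z \in C by rewrite -[_ \in _]negbK vN neq_ltn ltv orbT.
  have [nv /(_ z zC)/hasP[g gg /mnm_lepP gv] _] := wv; move/negP: nv; apply.
  apply/hasP; exists g => //; apply/mnm_lepP => k.
  have := gv k; rewrite mnmDE mnm1E; case: eqP => [<-|_]; last by rewrite addn0.
  by move=> _; apply: leq_trans (gN g gg z) _; apply: ltnW.
by rewrite vN eqn_leq vle; have := uv z; rewrite mnmE (negbTE zD).
Qed.

(** [xset] is a cover of the least possible size, so a cover contained in it is all of it. *)
Lemma xset_witness : exists v, witness gens xset v.
Proof.
have [C [v [wv sC]]] := cover_witness xset_cover; exists v.
suff <- : C = xset by [].
apply/eqP; rewrite eqEcard sC card_xset; exact/cover_card/(witness_cover wv).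
Qed.

(** A prime over the ideal contains [varprime C] for a cover [C], which leaves at most [m]
    variables; [xset] attains this. *)
Lemma dim_quot_whisker : dim_quot_is IK m.
Proof.
split.
  have [c [ch c0 _]] := varprime_chain K (subsetT xset).
  have cT : (#|[set: 'I_(m + m)]| - #|xset| = m)%N.
    by rewrite cardsT card_ord card_xset addnK.
  rewrite cT in ch; exists c; split=> //; rewrite c0.
  by have [v wv] := xset_witness; exact: Ass_sub (witness_Ass K wv).
move=> k c ch sI; have [cP _] := ch.
have [C [cC sC]] := prime_cover (cP 0%N isT) sI.
apply: leq_trans (prime_chain_length ch sC) _.
have := cardsC C; rewrite card_ord; have := cover_card cC; lia.
Qed.

(** * Condition (4) and the consequences of its failure *)

Definition cond4 := forall i,
  alpha gens (x i) (y i) = 1%N /\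
  forall j, H i j -> (mu gens (x i) (x j) <= mu gens (x i) (y i))%N.

Lemma le_mu u a b : u \in G -> Defs.msupp u = [set a; b] -> (u a <= mu gens a b)%N.
Proof. by move=> uG uE; rewrite /mu (big_rem u uG) /= uE eqxx leq_maxl. Qed.

Lemma mu_attained a b k : (k < mu gens a b)%N ->
  exists2 u, u \in G & Defs.msupp u = [set a; b] /\ (k < u a)%N.
Proof.
rewrite /mu; elim: (mingens gens) => [|u s IH]; first by rewrite big_nil.
rewrite big_cons; case: eqP => [uE|_].
  rewrite leq_max => /orP[ku|/IH[v vs vk]]; first by exists u; rewrite ?mem_head.
  by exists v; rewrite // inE vs orbT.
by case/IH=> v vs vk; exists v; rewrite // inE vs orbT.
Qed.

(* Proper divisors of a minimal generator that become multiples of generators once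
   the exponent of x_i, or that of y_i, is made large. *)
Lemma not_cond4_witness : ~ cond4 ->
  exists C v i, [/\ witness gens C v, x i \in C & y i \in C].
Proof.
move=> n4; have [i ni] := not_all_ex_not _ _ n4.
suff [t [u [tG ut nut [hx hy]]]] : exists t u, [/\ t \in G, (u <= t)%MM, u != t &
   (exists2 g, g \in G & forall z, z != x i -> g z <= u z)%N /\
   (exists2 g, g \in G & forall z, z != y i -> g z <= u z)%N].
  have nu := mingens_lt tG ut nut.
  have [N [uN gN]] := gens_bound gens u.
  have [C [v [wv /mnm_lepP uv vN]]] := exists_witness uN gN nu.
  have [nv _ _] := wv.
  (* If [a] were off [C], then [v a = N] and the generator [g] would divide [v]. *)
  have inC a : (exists2 g, g \in G & forall z, z != a -> g z <= u z)%N -> a \in C.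
    case=> g /mem_mingens[gg _] gu; apply/negPn; rewrite vN; apply: contra nv => /eqP va.
    apply/hasP; exists g => //; apply/mnm_lepP => z.
    have [->|za] := eqVneq z a; first by rewrite va; apply: gN.
    by apply: leq_trans (uv z); apply: gu.
  by exists C, v, i; split=> //; apply: inC.
have [t tG tE] := whisker_gen i; have [tx ty] := msupp_gt0 tE.
have xy : x i != y i by rewrite eq_lrshift.
have [al1|al1] := eqVneq (alpha gens (x i) (y i)) 1%N.
  have [j [Hij]] : exists j, H i j /\ ~ (mu gens (x i) (x j) <= mu gens (x i) (y i))%N.
    have [j nj] : exists j, ~ (H i j -> (mu gens (x i) (x j) <= mu gens (x i) (y i))%N).
      by apply: not_all_ex_not => h; apply: ni.
    by exists j; apply: imply_to_and nj.
  move/negP; rewrite -ltnNge => /(leq_ltn_trans (le_mu tG tE))/mu_attained[s sG [sE lts]].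
  (* Lower the [x i]-exponent of [s] to that of [t]: raising it again yields a multiple of [s],
     raising [y i] a multiple of [t]. *)
  exists s, [multinom if z == x i then t z else s z | z < _]; split=> //.
  - by apply/mnm_lepP => z; rewrite mnmE; case: eqP => // ->; apply: ltnW.
  - by apply/eqP => /mnmP/(_ (x i)); rewrite mnmE eqxx => e; rewrite e ltnn in lts.
  - split; [exists s|exists t] => // z zi; rewrite mnmE; first by rewrite (negbTE zi).
    by case: eqP => // /eqP zx; rewrite (msupp_eq0 tE).
have [s [sG sE st]] : exists s, [/\ s \in G, Defs.msupp s = [set x i; y i] & s != t].
  apply: NNPP => ns; move/eqP: al1; apply; rewrite /alpha.
  rewrite (eq_in_count (a2 := pred1 t)); last first.
    move=> u uG /=; apply/eqP/eqP => [uE|->//].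
    by apply: NNPP => ut; apply: ns; exists u; split=> //; apply/eqP.
  by rewrite count_uniq_mem ?tG // undup_uniq.
(* The gcd of two generators on one whisker: raising [x i] or [y i] yields a multiple of one or the
   other. *)
pose u := [multinom minn (s z) (t z) | z < m + m].
have ut : (u <= t)%MM by apply/mnm_lepP => z; rewrite mnmE geq_minr.
have us : (u <= s)%MM by apply/mnm_lepP => z; rewrite mnmE geq_minl.
have le_xy (g h : 'X_{1..m + m}) : Defs.msupp g = [set x i; y i] ->
    (g (x i) <= h (x i))%N -> (g (y i) <= h (y i))%N -> (g <= h)%MM.
  move=> gE gx gy; apply/mnm_lepP => z.
  have [->//|zx] := eqVneq z (x i); have [->//|zy] := eqVneq z (y i).
  by rewrite (msupp_eq0 gE).
have nle (g h : 'X_{1..m + m}) : g \in G -> h \in G -> g != h -> ~ (g <= h)%MM.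
  by move=> /mem_mingens[gg _] /mem_mingens[_ hm] + /(hm _ gg) => /eqP.
have hlt (g h : 'X_{1..m + m}) : g \in G -> h \in G -> g != h ->
    Defs.msupp g = [set x i; y i] -> Defs.msupp h = [set x i; y i] ->
    (g (x i) <= h (x i))%N -> (h (y i) < g (y i))%N.
  by move=> gG hG gh gE hE gx; rewrite ltnNge; apply/negP => /(le_xy _ _ gE gx)/nle; apply.
have wits (g h : 'X_{1..m + m}) : g \in G -> h \in G -> g != h ->
    Defs.msupp g = [set x i; y i] -> Defs.msupp h = [set x i; y i] ->
    (forall z, u z = minn (g z) (h z)) -> (g (x i) <= h (x i))%N ->
   (exists2 k, k \in G & forall z, z != x i -> k z <= u z)%N /\
   (exists2 k, k \in G & forall z, z != y i -> k z <= u z)%N.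
  move=> gG hG gh gE hE uE gx; have hy := hlt g h gG hG gh gE hE gx.
  split; [exists h|exists g] => // z za; rewrite uE leq_min leqnn ?andbT /=.
    have [->|zy] := eqVneq z (y i); first exact: ltnW.
    by rewrite (msupp_eq0 hE).
  have [->//|zx] := eqVneq z (x i).
  by rewrite (msupp_eq0 gE).
exists t, u; split=> //.
  apply/eqP => e; apply: (nle t s) => //; first by rewrite eq_sym.
  by rewrite -e.
have [le_st|/ltnW le_ts] := leqP (s (x i)) (t (x i)).
  by apply: (wits s t) => // z; rewrite mnmE.
by apply: (wits t s) => // [|z]; rewrite 1?eq_sym // mnmE minnC.
Qed.

Lemma not_cond4 : ~ cond4 ->
  [/\ ~ cohen_macaulay (mon_ideal K gens), ~ unmixed IK & ~ no_embedded_primes IK].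
Proof.
case/not_cond4_witness=> C [v [i [wv xC yC]]].
have cC := witness_cover wv; have gtC := cover_card_gt cC xC yC; split.
- case=> d [[[fs [reg sfs]] _] dimd].
  have := witness_regular_seq wv reg; rewrite sfs.
  have [[c [ch cI]] _] := dim_quot_whisker; have [_ /(_ _ _ ch cI)] := dimd.
  have := cardsC C; rewrite card_ord; lia.
- move=> um; have [u wu] := xset_witness.
  have [h [h1 h2]] := um _ _ (witness_Ass K wv) (witness_Ass K wu).
  have := height_is_unique (varprime_height K C) h1.
  have := height_is_unique (varprime_height K xset) h2.
  rewrite card_xset; lia.
(* A generator involving the leaf [y i] also involves [x i], which stays in the cover. *)
- apply; have cD : cover (C :\ y i).
    move=> u uG; have [j jC uj] := cC u uG.
    have [ej|nj] := eqVneq j (y i); last by exists j; rewrite // !inE nj.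
    exists (x i); first by rewrite !inE xC eq_lrshift.
    by rewrite ej in uj; case: (msupp_gt0 (edge_at_y uG uj)).
  have [D [u [wu sD]]] := cover_witness cD.
  exists (varprime D), (varprime C); split; [exact: witness_Ass wu|exact: witness_Ass wv|].
  by apply: varprime_strict; apply: sub_proper_trans sD _; apply: properD1.
Qed.

End Whiskers.

(** * The regular sequence of whisker differences *)

Lemma comp_mpoly_congr (K : fieldType) n (J : ideal_of K n) (t : n.-tuple {mpoly K[n]}) p :
  is_ideal J -> (forall z, J (tnth t z - 'X_z)) -> J (p \mPo t - p).
Proof.
move=> iJ Jt.
have congrM (a b c d : {mpoly K[n]}) : J (a - b) -> J (c - d) -> J (a * c - b * d).
  move=> Jab Jcd; have -> : a * c - b * d = (a - b) * c + b * (c - d) by ring.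
  by apply: (is_idealD iJ); [apply: is_idealMr | apply: is_idealMl].
have congr1 : J (1 - 1) by rewrite subrr; apply: is_ideal0.
elim/mpolyind: p => [|c u p _ _ IH]; first by rewrite comp_mpoly0 subrr; apply: is_ideal0.
rewrite comp_mpolyD comp_mpolyZ opprD addrACA -scalerBr; apply: (is_idealD iJ) => //.
rewrite -mul_mpolyC; apply: (is_idealMl _ iJ); rewrite comp_mpolyX mpolyXE_id.
apply: (big_ind2 (fun a b => J (a - b))) => // z _.
by elim: (u z) => [|k IHk]; rewrite ?expr0 // !exprS; apply: congrM.
Qed.

Section Collapse.
Variables (K : fieldType) (m : nat) (gens : seq 'X_{1..m + m}).
Local Notation S := {mpoly K[m + m]}.
Local Notation x := (@lshift m m).
Local Notation y := (@rshift m m).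
Implicit Types (i j : 'I_m) (u v : 'X_{1..m + m}) (A : {set 'I_m}).

Definition collapse A u : 'X_{1..m + m} := [multinom match split z with
  | inl i => (u (x i) + (if i \in A then u (y i) else 0))%N
  | inr i => if i \in A then 0%N else u (y i)
  end | z < m + m].

Lemma collapse_x A u i : collapse A u (x i) = (u (x i) + (if i \in A then u (y i) else 0))%N.
Proof. by rewrite mnmE (unsplitK (inl i)). Qed.

Lemma collapse_y A u i : collapse A u (y i) = if i \in A then 0%N else u (y i).
Proof. by rewrite mnmE (unsplitK (inr i)). Qed.

Lemma collapse0 u : collapse set0 u = u.
Proof.
by apply/mnmP => z; case: (split_ordP z) => i ->; rewrite ?collapse_x ?collapse_y inE ?addn0.
Qed.

Lemma collapse_le A u v : (u <= v)%MM -> (collapse A u <= collapse A v)%MM.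
Proof.
move/mnm_lepP=> uv; apply/mnm_lepP => z; case: (split_ordP z) => i ->.
  by rewrite !collapse_x; apply: leq_add => //; case: ifP.
by rewrite !collapse_y; case: ifP.
Qed.

Definition collapse_tuple A : (m + m).-tuple S := [tuple match split z with
  | inl i => 'X_(x i) | inr i => if i \in A then 'X_(x i) else 'X_(y i) end | z < m + m].
Local Notation phi A := (comp_mpoly (collapse_tuple A)).

Lemma tnth_collapse_x A i : tnth (collapse_tuple A) (x i) = 'X_(x i).
Proof. by rewrite tnth_mktuple (unsplitK (inl i)). Qed.

Lemma tnth_collapse_y A i :
  tnth (collapse_tuple A) (y i) = if i \in A then 'X_(x i) else 'X_(y i).
Proof. by rewrite tnth_mktuple (unsplitK (inr i)). Qed.

Lemma collapseX A u : phi A 'X_[u] = 'X_[collapse A u].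
Proof.
rewrite comp_mpolyX [RHS]mpolyXE_id !big_split_ord /= -!big_split /=.
apply: eq_bigr => i _; rewrite tnth_collapse_x tnth_collapse_y collapse_x collapse_y.
by case: ifP => _; rewrite ?addn0 // exprD expr0 mulr1.
Qed.

Definition theta i : S := 'X_(y i) - 'X_(x i).

Lemma collapse_theta A i : phi A (theta i) = if i \in A then 0 else theta i.
Proof.
rewrite /theta raddfB /= !comp_mpolyXU -!tnth_nth tnth_collapse_x tnth_collapse_y.
by case: ifP => // _; rewrite subrr.
Qed.

(** The substitution kills each adjoined [theta i] and collapses the generators; conversely it
    changes a polynomial only by a combination of these differences. *)
Lemma collapse_ideal (s : seq 'I_m) (p : S) :
  ideal_gen (mon_ideal K gens ++ map theta s) p <->
  monideal (divisible (map (collapse [set i in s]) gens)) (phi [set i in s] p).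
Proof.
set A := [set i in s]; set J := ideal_gen _.
have iJ : is_ideal J := ideal_gen_is_ideal _.
have iM := monideal_is_ideal K (@divisible_upclosed _ (map (collapse A) gens)).
split.
  apply: (ideal_gen_min (J := fun p => monideal _ (phi A p))).
    split=> [|a b Ja Jb|r a Ja]; first by rewrite comp_mpoly0; apply: (is_ideal0 iM).
      by rewrite comp_mpolyD; apply: (is_idealD iM).
    by rewrite rmorphM; apply: (is_idealMl _ iM).
  move=> f; rewrite mem_cat => /orP[]/mapP[u us ->].
    rewrite collapseX; apply/monidealX/hasP.
    by exists (collapse A u); [apply: map_f | apply: lepm_refl].
  by rewrite collapse_theta inE us; apply: (is_ideal0 iM).
have Jphi q : J (phi A q - q).
  apply: comp_mpoly_congr => // z; case: (split_ordP z) => i ->.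
    by rewrite tnth_collapse_x subrr; apply: is_ideal0.
  rewrite tnth_collapse_y inE; case: ifP => [si|_]; last by rewrite subrr; apply: is_ideal0.
  have -> : 'X_(x i) - 'X_(y i) = - theta i by rewrite /theta opprB.
  by apply: (is_idealN iJ); apply: mem_ideal_gen; rewrite mem_cat map_f ?orbT.
move=> Mp; have -> : p = phi A p - (phi A p - p) by rewrite subKr.
apply: (is_idealB iJ) => //; apply: mpoly_ideal_ind => // v /Mp/hasP[_ /mapP[u ug ->] uv].
rewrite -(submK uv) mpolyXD; apply: (is_idealMl _ iJ); rewrite -collapseX.
have -> : phi A 'X_[u] = (phi A 'X_[u] - 'X_[u]) + 'X_[u] by rewrite subrK.
apply: (is_idealD iJ) => //; apply: mem_ideal_gen.
by rewrite mem_cat map_f.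
Qed.

Lemma divisible_collapse A v :
  divisible (map (collapse A) gens) v = divisible (map (collapse A) (mingens gens)) v.
Proof.
apply/hasP/hasP => -[_ /mapP[u ug ->] uv]; last first.
  by exists (collapse A u) => //; apply: map_f; case/mem_mingens: ug.
have : divisible gens u by apply/hasP; exists u; rewrite ?lepm_refl.
rewrite divisible_mingens => /hasP[g gG gu]; exists (collapse A g); first exact: map_f.
exact: lepm_trans (collapse_le _ gu) uv.
Qed.

End Collapse.

(** * Consequences of condition (4) *)

Section CohenMacaulay.
Variables (K : fieldType) (m : nat) (H : rel 'I_m) (gens : seq 'X_{1..m + m}).
Hypotheses (Isupp2 : support2 gens)
  (IG : forall a b : 'I_(m + m), ugraph_edge gens a b <-> whisker_edge H a b)
  (c4 : cond4 H gens).
Local Notation x := (@lshift m m).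
Local Notation y := (@rshift m m).
Local Notation G := (mingens gens).
Local Notation IK := (ideal_gen (mon_ideal K gens)).
Local Notation varprime := (@varprime K (m + m)).
Implicit Types (i j : 'I_m) (u v : 'X_{1..m + m}) (C D : {set 'I_(m + m)}).

Lemma whisker_exp u i : u \in G -> (0 < u (y i))%N -> u (x i) = mu gens (x i) (y i).
Proof.
move=> uG /(edge_at_y Isupp2 IG uG) uE; have [al _] := c4 i.
move: al; rewrite /alpha -size_filter => al; rewrite /mu -big_filter.
have : u \in [seq v <- G | Defs.msupp v == [set x i; y i]] by rewrite mem_filter uE eqxx.
by case: [seq _ <- _ | _] al => [|t []] // _; rewrite inE => /eqP->; rewrite big_seq1.
Qed.

(** The inequality of condition (4) enters here, since a generator involving [x i] sits on the
    whisker or on an edge of [H]. *)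
Lemma gen_exp_le u i : u \in G -> (u (x i) <= mu gens (x i) (y i))%N.
Proof.
move=> uG; have [->//|ux] := posnP (u (x i)).
have [uE|[j Hij uE]] := edge_at_x Isupp2 IG uG ux; first exact: le_mu.
by apply: leq_trans (le_mu uG uE) _; case: (c4 i) => _; apply.
Qed.

(** The threshold is the whisker exponent of [x i]: generators involving [y i] have exactly this
    exponent, all others at most this one, and collapsing along [A] leaves both coordinates of
    whisker [i] unchanged. *)
Lemma theta_regular (A : {set 'I_m}) i (g : {mpoly K[m + m]}) : i \notin A ->
  monideal (divisible (map (collapse A) gens)) (g * theta K i) ->
  monideal (divisible (map (collapse A) gens)) g.
Proof.
move=> /negbTE iA; apply: (monideal_regular (w := mu gens (x i) (y i))).
- exact: divisible_upclosed.
- by rewrite eq_lrshift.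
- move=> v lt_v; rewrite divisible_collapse => /hasP[_ /mapP[u uG ->] /mnm_lepP uv].
  rewrite divisible_collapse; apply/hasP; exists (collapse A u); first exact: map_f.
  apply/mnm_lepP => z; have := uv z; rewrite mnmDE mnm1E.
  case: eqP => [<- _|_]; last by rewrite addn0.
  rewrite collapse_y iA; have [->//|uy] := posnP (u (y i)).
  have := uv (x i); rewrite mnmDE mnm1E eq_rlshift addn0 collapse_x iA addn0.
  by rewrite (whisker_exp uG uy) leqNgt lt_v.
- move=> v le_v; rewrite divisible_collapse => /hasP[_ /mapP[u uG ->] /mnm_lepP uv].
  rewrite divisible_collapse; apply/hasP; exists (collapse A u); first exact: map_f.
  apply/mnm_lepP => z; have := uv z; rewrite mnmDE mnm1E.
  case: eqP => [<- _|_]; last by rewrite addn0.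
  by rewrite collapse_x iA addn0; apply: leq_trans (gen_exp_le _ uG) le_v.
Qed.

Lemma theta_regular_seq : regular_seq (mon_ideal K gens) (map (@theta K m) (enum 'I_m)).
Proof.
have szE : size (map (@theta K m) (enum 'I_m)) = m by rewrite size_map size_enum_ord.
have theta0 i : (theta K i)@_0 = 0.
  by rewrite /theta mcoeffB !mcoeffX !mnm1_eq0 subrr.
split=> [k|k|].
- rewrite szE => lt_k; rewrite (nth_map (Ordinal lt_k)) ?size_enum_ord //; exact: theta0.
- rewrite szE => lt_k g; set i := Ordinal lt_k.
  rewrite (nth_map i) ?size_enum_ord // (nth_ord_enum i i) -map_take !collapse_ideal.
  have iA : i \notin [set j in take k (enum 'I_m)].
    rewrite inE; apply/negP => /(nthP i)[j]; rewrite size_take size_enum_ord lt_k => lt_j.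
    rewrite nth_take // => /(congr1 val); rewrite /= nth_enum_ord; last exact: ltn_trans lt_j lt_k.
    by move=> e; rewrite e ltnn in lt_j.
  by rewrite rmorphM /= collapse_theta (negbTE iA); apply: theta_regular.
- have imax : is_ideal (@max_homog K (m + m)).
    split=> [|a b a0 b0|r a a0]; first exact: mcoeff0.
      by rewrite /max_homog mcoeffD a0 b0 addr0.
    by rewrite /max_homog rmorphM /= a0 mulr0.
  move/(ideal_gen_min imax); rewrite /max_homog mcoeff1 eqxx => h.
  suff /h/eqP : forall f, f \in mon_ideal K gens ++ map (@theta K m) (enum 'I_m) -> f@_0 = 0.
    by rewrite oner_eq0.
  move=> f; rewrite mem_cat => /orP[]/mapP[u us ->]; last exact: theta0.
  rewrite mcoeffX; case: eqP => // u0.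
  have : divisible gens 0%MM by apply/hasP; exists u; rewrite ?u0 ?lepm_refl -?u0.
  rewrite divisible_mingens => /hasP[g gG /mnm_lepP g0]; have := Isupp2 gG.
  suff -> : Defs.msupp g = set0 by rewrite cards0.
  by apply/setP => z; rewrite !inE; have := g0 z; rewrite mnm0E leqn0 => /eqP->.
Qed.

Lemma Ass_card P : Ass IK P -> exists2 C, same_ideal P (varprime C) & #|C| = m.
Proof.
move=> aP; have [C PC] := Ass_varprime aP; exists C => //.
have cC : cover gens C by apply: (varprime_cover (K := K)) => g /(Ass_sub aP)/PC.
have [[iP P1 _] [f Pf]] := aP.
have nxy i : ~~ ((x i \in C) && (y i \in C)).
  apply/negP => /andP[/(varprimeX K)/PC Px /(varprimeX K)/PC Py]; apply: P1.
  (* As [P] is [I : f], regularity of [theta K i] modulo [I] itself, the case of empty [A], puts [f]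
     in [I] and 1 in [P]. *)
  have /Pf : P (theta K i) by apply: (is_idealB iP).
  rewrite ideal_gen_monomials mulrC => If; apply/Pf/ideal_gen_monomials; rewrite mul1r.
  have g0 : map (collapse set0) gens = gens.
    by rewrite -[RHS]map_id; apply: eq_map => u; apply: collapse0.
  by rewrite -g0; apply: (@theta_regular _ i); rewrite ?inE // g0.
rewrite card_xy -[RHS]card_ord -sum1_card; apply: eq_bigr => i _.
by have := cover_xy IG i cC; have := nxy i; case: (_ \in C); case: (_ \in C).
Qed.

Lemma cond4_unmixed : unmixed IK.
Proof.
move=> P Q /Ass_card[C PC cC] /Ass_card[D QD cD]; exists m; split.
  apply: (@height_is_ext _ _ (varprime C)); first by move=> ?; rewrite PC.
  by have := varprime_height K C; rewrite cC.
apply: (@height_is_ext _ _ (varprime D)); first by move=> ?; rewrite QD.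
by have := varprime_height K D; rewrite cD.
Qed.

Lemma cond4_no_embedded : no_embedded_primes IK.
Proof.
case=> P [Q [/Ass_card[C PC cC] /Ass_card[D QD cD] [sPQ [p [Qp nPp]]]]].
have sCD : C \subset D by apply/(varprime_sub K) => q /PC/sPQ/QD.
have CD : C = D by apply/eqP; rewrite eqEcard sCD cC cD /=.
by apply: nPp; apply/PC; rewrite CD; apply/QD.
Qed.

Lemma cond4_cohen_macaulay : cohen_macaulay (mon_ideal K gens).
Proof.
exists m; split; last exact: (dim_quot_whisker K Isupp2 IG).
split.
  exists (map (@theta K m) (enum 'I_m)); split; first exact: theta_regular_seq.
  by rewrite size_map size_enum_ord.
move=> fs reg; have [v wv] := xset_witness K Isupp2 IG.
have := witness_regular_seq wv reg; have := cardsC (xset m).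
by rewrite card_ord card_xset => /addnI ->.
Qed.

End CohenMacaulay.

Theorem theorem3p7 (K : fieldType) (m : nat) (H : rel 'I_m)
  (H_irr : irreflexive H) (H_sym : forall i j, H i j = H j i)
  (gens : seq 'X_{1..m + m})
  (Isupp2 : support2 gens)
  (IG : forall a b : 'I_(m + m), ugraph_edge gens a b <-> whisker_edge H a b) :
  let I := mon_ideal K gens in
  [/\ (cohen_macaulay I <-> unmixed (ideal_gen I)),
      (unmixed (ideal_gen I) <-> no_embedded_primes (ideal_gen I)) &
      (no_embedded_primes (ideal_gen I) <->
        forall i : 'I_m,
          alpha gens (lshift m i) (rshift m i) = 1%N /\
          forall j : 'I_m, H i j ->
            (mu gens (lshift m i) (lshift m j) <= mu gens (lshift m i) (rshift m i))%N)].
Proof.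
move=> I; rewrite -/(cond4 H gens).
(* Under (4) the other three statements all hold; without it they all fail. *)
have [c4|n4] := classic (cond4 H gens).
  have cm := cond4_cohen_macaulay K Isupp2 IG c4.
  have um := cond4_unmixed (K := K) Isupp2 IG c4.
  by have ne := cond4_no_embedded (K := K) Isupp2 IG c4.
by have [ncm num nne] := not_cond4 K Isupp2 IG n4.
Qed.
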